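(* Let $\mathcal{G}_h$ be a subdivision of a domain $\Omega$, let $W_h$ be a finite element space on $\mathcal{G}_h$ of dimension $n$ with a basis $\{\phi_k\}_{k=1}^n$, and let $\mathcal{D}_1,\dots,\mathcal{D}_n$ be subdomains of $\Omega$. The following are equivalent. (1) There exist linear functionals $\lambda_1^{\rm d},\dots,\lambda_n^{\rm d}$, with $W_h$ contained in the domain of each $\lambda_k^{\rm d}$ and with $\lambda_k^{\rm d}(v)$ depending only on the information of $v$ on $\mathcal{D}_k$ for each $k$, such that the interpolation $$I_h^{\rm d}v=\sum_{k=1}^n\lambda_k^{\rm d}(v)\,\phi_k$$ preserves $W_h$, i.e. $I_h^{\rm d}w=w$ for all $w\in W_h$. (2) For each $k=1,\dots,n$, the restriction $\phi_k|_{\mathcal{D}_k}$ cannot be represented as a linear combination of the functions in $\Phi^*_{\mathcal{D}_k}$.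
   Context: $W_h$ is a finite-dimensional space of piecewise polynomial functions in $L^2(\Omega)$. $\mathcal{M}_m$ denotes the support of $\phi_m$, and $\mathring{\mathcal{D}}$ denotes the interior of $\mathcal{D}$. For each $k$, $\Phi^*_{\mathcal{D}_k}$ is the family of restrictions $\phi_m|_{\mathcal{D}_k}$, $1\le m\le n$, $m\ne k$, with $\mathcal{M}_m\cap\mathring{\mathcal{D}_k}\neq\varnothing$ (if the family is empty, only the zero function is a linear combination of it). ''$\lambda_k^{\rm d}(v)$ depends only on the information of $v$ on $\mathcal{D}_k$'' means that $\lambda_k^{\rm d}(v)=\lambda_k^{\rm d}(w)$ whenever $v|_{\mathcal{D}_k}=w|_{\mathcal{D}_k}$. *)

(* Defs.v *)
From HB Require Import structures.
From mathcomp Require Import all_boot all_order all_algebra.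
From mathcomp Require Import all_classical all_reals all_analysis.
From mathcomp Require mpoly.
Import Order.TTheory GRing.Theory Num.Theory.
Import numFieldNormedType.Exports.

Set Implicit Arguments.
Unset Strict Implicit.
Unset Printing Implicit Defensive.

Local Open Scope classical_set_scope.
Local Open Scope ring_scope.

Section measurable_rV.
Context (R : realType) (d : nat).

Definition rV_coord (i : 'I_d) (x : 'rV[R]_d) : measurableTypeR R := x 0 i.

Let rV_set0 : g_sigma_preimage rV_coord set0.
Proof. exact: sigma_algebra0. Qed.

Let rV_setC A : g_sigma_preimage rV_coord A -> g_sigma_preimage rV_coord (~` A).
Proof. exact: sigma_algebraC. Qed.

Let rV_bigcup (F : _^nat) : (forall i, g_sigma_preimage rV_coord (F i)) ->
  g_sigma_preimage rV_coord (\bigcup_i (F i)).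
Proof. exact: sigma_algebra_bigcup. Qed.

(* The sigma-algebra generated by the coordinates, which is the Borel one: see
   open_measurable_rV. *)
HB.instance Definition _ := @isMeasurable.Build default_measure_display
  'rV[R]_d (g_sigma_preimage rV_coord) rV_set0 rV_setC rV_bigcup.

Lemma measurable_rV_coord (i : 'I_d) :
  measurable_fun [set: 'rV[R]_d] (rV_coord i).
Proof.
move=> _ Y mY; rewrite setTI; apply: sub_sigma_algebra => /=.
rewrite -bigcup_seq/=; exists i => /=; first by rewrite mem_index_enum.
by exists Y => //; rewrite setTI.
Qed.

Lemma measurable_fun_rV d1 (T : measurableType d1) (f : T -> 'rV[R]_d) :
  (forall i, measurable_fun [set: T] (rV_coord i \o f)) ->
  measurable_fun [set: T] f.
Proof.
move=> mf.
suff prefS : g_sigma_preimage (fun i => rV_coord i \o f) `<=` measurable.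
  rewrite g_sigma_preimage_comp in prefS.
  by move=> _ A mA; apply: prefS; exists A.
apply: smallest_sub; first exact: sigma_algebra_measurable.
rewrite -bigcup_seq; apply: bigcup_sub => i _ A [B mB <-].
exact: mf.
Qed.

End measurable_rV.

Section lebesgue_rV.
Context (R : realType).

Definition cons_rV d (p : measurableTypeR R * 'rV[R]_d) : 'rV[R]_d.+1 :=
  \row_i if unlift ord0 i is Some j then p.2 0 j else p.1.

Definition uncons_rV d (x : 'rV[R]_d.+1) : measurableTypeR R * 'rV[R]_d :=
  (x 0 ord0, \row_j x 0 (lift ord0 j)).

Lemma cons_rVK d : cancel (@cons_rV d) (@uncons_rV d).
Proof.
move=> [a v]; congr pair; first by rewrite mxE unlift_none.
by apply/rowP => j; rewrite !mxE liftK.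
Qed.

Lemma measurable_cons_rV d : measurable_fun setT (@cons_rV d).
Proof.
apply: measurable_fun_rV => i; rewrite /comp /rV_coord.
have [j|] := unliftP ord0 i => ->.
  rewrite (_ : (fun _ => _) = rV_coord j \o snd).
    by apply: measurableT_comp => //; exact: measurable_rV_coord.
  by apply/funext => p; rewrite /= mxE liftK.
rewrite (_ : (fun _ => _) = fst) //.
by apply/funext => p; rewrite /= mxE unlift_none.
Qed.

Lemma measurable_uncons_rV d : measurable_fun setT (@uncons_rV d).
Proof.
apply/measurable_fun_pairP; split.
  exact: (@measurable_rV_coord R d.+1 ord0).
apply: measurable_fun_rV => j.
rewrite (_ : _ \o _ = rV_coord (lift ord0 j)).
  exact: measurable_rV_coord.
by apply/funext => x; rewrite /= /rV_coord mxE.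
Qed.

Let leb0 : set 'rV[R]_0 -> \bar R := dirac (0 : 'rV[R]_0).

HB.instance Definition _ := Measure.on leb0.

Let leb0_sigma_finite : sigma_finite setT leb0.
Proof.
exists (fun=> setT); first by rewrite bigcup_const.
by move=> _; split => //; rewrite /leb0 diracT ltry.
Qed.

HB.instance Definition _ :=
  Measure_isSigmaFinite.Build _ _ _ leb0 leb0_sigma_finite.

Section lebesgueS.
Context d (mu : {sigma_finite_measure set 'rV[R]_d -> \bar R}).

Let lebS : set 'rV[R]_d.+1 -> \bar R :=
  pushforward (@lebesgue_measure R \x mu)%E (@cons_rV d).

Let lebS0 : lebS set0 = 0%E.
Proof. by rewrite /lebS /pushforward preimage_set0 measure0. Qed.

Let lebS_ge0 A : (0 <= lebS A)%E.
Proof. exact: (measure_ge0 (@lebesgue_measure R \x mu)%E). Qed.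

Let lebS_sigma_additive : semi_sigma_additive lebS.
Proof.
have := @measurable_cons_rV d => mf.
exact: (measure_semi_sigma_additive (s := pushforward _ (@cons_rV d))).
Qed.

HB.instance Definition _ := isMeasure.Build _ _ _ lebS
  lebS0 lebS_ge0 lebS_sigma_additive.

Let lebS_sigma_finite : sigma_finite setT lebS.
Proof.
have /sigma_finiteP[F [TF ndF Foo]] := sigma_finiteT (@lebesgue_measure R).
have /sigma_finiteP[G [TG ndG Goo]] := sigma_finiteT mu.
exists (fun n => @uncons_rV d @^-1` (F n `*` G n)).
  rewrite -preimage_bigcup (_ : \bigcup_n _ = setT) ?preimage_setT//.
  rewrite -setXTT TF TG predeqE => -[x y]; split.
    by move=> [n _ [/= Fx Gy]]; split; exists n.
  move=> [/= [n _ Fnx] [k _ Gky]]; exists (maxn n k) => //; split.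
  - by move: x Fnx; exact/subsetPset/ndF/leq_maxl.
  - by move: y Gky; exact/subsetPset/ndG/leq_maxr.
move=> n; have [mFn Fn] := Foo n; have [mGn Gn] := Goo n; split.
  rewrite -[X in measurable X]setTI; apply: measurable_uncons_rV => //.
  exact: measurableX.
rewrite /lebS /pushforward -comp_preimage (_ : _ \o _ = id) ?preimage_id.
  by rewrite product_measure1E// lte_mul_pinfty// ge0_fin_numE.
by apply/funext => p /=; rewrite cons_rVK.
Qed.

HB.instance Definition _ :=
  Measure_isSigmaFinite.Build _ _ _ lebS lebS_sigma_finite.

Definition lebesgueS : {sigma_finite_measure set 'rV[R]_d.+1 -> \bar R} := lebS.

End lebesgueS.

(* Lebesgue measure on R^d, restricted to Borel sets. *)
Fixpoint lebesgue_rV d : {sigma_finite_measure set 'rV[R]_d -> \bar R} :=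
  if d is d'.+1 then lebesgueS (lebesgue_rV d') else leb0.

Lemma lebesgue_rV_prod d (A : 'I_d -> set (measurableTypeR R)) :
  (forall i, measurable (A i)) ->
  lebesgue_rV d [set x | forall i, A i (x 0 i)] =
  (\big[*%E/1%E]_(i < d) lebesgue_measure (A i))%E.
Proof.
elim: d A => [|d IH] A mA.
  by rewrite big_ord0 /= /leb0 diracE mem_set// => -[].
rewrite big_ord_recl -IH => [|i]; last exact: mA.
have mB : measurable [set v : 'rV[R]_d | forall i, A (lift ord0 i) (v 0 i)].
  rewrite (_ : [set _ | _] =
      \bigcap_(i in [set: 'I_d]) (rV_coord i @^-1` A (lift ord0 i))).
    apply: fin_bigcap_measurable => // i _; rewrite -[X in measurable X]setTI.
    exact: measurable_rV_coord.
  by apply/seteqP; split => v h i; [move=> _|]; exact: h.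
rewrite -(product_measure1E _ (lebesgue_rV d))// [LHS]/= /pushforward.
congr product_measure1; apply/seteqP; split => -[a v] /=.
  move=> h; split; first by have := h ord0; rewrite mxE unlift_none.
  by move=> i; have := h (lift ord0 i); rewrite mxE liftK.
move=> [ha hv] i; rewrite mxE.
by have [j|] := unliftP ord0 i => ->.
Qed.

End lebesgue_rV.

Lemma open_measurable_rV (R : realType) d (U : set 'rV[R]_d) :
  open U -> measurable U.
Proof.
move=> oU.
pose B (q : 'rV[rat]_d * nat) : set 'rV[R]_d :=
  [set x | forall i, `|ratr (q.1 0 i) - x 0 i| < q.2.+1%:R^-1].
have mB q : measurable (B q).
  rewrite (_ : B q = \bigcap_(i in [set: 'I_d]) (rV_coord i @^-1`
      (ball (ratr (q.1 0 i) : R) (q.2.+1%:R^-1)))).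
    apply: fin_bigcap_measurable => // i _; rewrite -[X in measurable X]setTI.
    apply: measurable_rV_coord => //; rewrite ball_itv; exact: measurable_itv.
  by apply/seteqP; split => v h i; [move=> _|]; exact: h.
rewrite (_ : U = \bigcup_q (if `[< B q `<=` U >] then B q else set0)).
  by apply: countable_bigcupT_measurable => // q; case: ifP.
apply/seteqP; split => [x Ux|x [q _]]; last first.
  by case: asboolP => // BU /BU.
have /nbhs_ballP[e /= e0 xeU] := open_nbhs_nbhs (conj oU Ux).
have [k ke] : exists k : nat, k.+1%:R^-1 < e / 2.
  have [k] := ltr_add_invr (divr_gt0 e0 (ltr0n _ 2) : 0 < e / 2).
  by rewrite add0r => ?; exists k.
have k0 : 0 < k.+1%:R^-1 :> R by rewrite invr_gt0 ltr0n.
have /choice[q xq] : forall i : 'I_d, exists q : rat,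
    `|ratr q - x 0 i| < k.+1%:R^-1.
  move=> i.
  have [|q] := @rat_in_itvoo R (x 0 i - k.+1%:R^-1) (x 0 i + k.+1%:R^-1).
    by rewrite ltrBlDr -addrA ltrDl addr_gt0.
  by rewrite in_itv/= => qi; exists q; rewrite ltr_distl.
exists (\row_i q i, k) => //; rewrite asboolT.
  by move=> i; rewrite /= mxE.
move=> y By; apply: xeU; split => // i j; rewrite (ord1 i) /ball/=.
have := By j; rewrite /= mxE => qy.
rewrite (le_lt_trans (ler_distD (ratr (q j)) _ _))// (splitr e) ltrD//.
  by rewrite distrC (lt_trans (xq j)).
by rewrite (lt_trans qy).
Qed.

Section finite_element.
Context (R : realType) (d : nat).
Implicit Types (Om D : set 'rV[R]_d) (G : set (set 'rV[R]_d)).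
Implicit Types (v w : 'rV[R]_d -> R) (V W : set ('rV[R]_d -> R)).

Local Notation mu := (lebesgue_rV R d).

Definition is_domain Om : Prop := [/\ open Om, connected Om & Om !=set0].

(* D need not be open: a closed cell, or a closed patch of cells, is allowed,
   and then need not be included in the open set Om.  The last condition says
   that the part of the boundary that D contains has measure zero, so that the
   restriction to D of a class of functions on Om modulo equality almost
   everywhere is well defined. *)
Definition is_subdomain Om D : Prop :=
  [/\ is_domain D°, D° `<=` Om, D `<=` closure D°
    & mu.-negligible (D `\` D°)].

Definition is_subdivision Om G : Prop :=
  [/\ finite_set G,
      forall K, G K -> is_subdomain Om K,
      forall K L, G K -> G L -> K <> L -> K° `&` L° = set0
    & mu.-negligible (Om `\` \bigcup_(K in G) K)].

Definition piecewise_polynomial G v : Prop :=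
  forall K, G K -> exists p : mpoly.mpoly d R,
    v = (fun x => mpoly.meval (fun i => x 0 i) p) %[ae mu in K].

(* An element of L^2(Om) is represented by a function v on R^d whose values
   outside Om are irrelevant; two such functions represent the same element
   when they are equal almost everywhere in Om. *)
Definition L2 Om v : Prop := v \_ Om \in Lfun mu 2%:E.

(* The finite dimension of W is given by is_basis. *)
Definition is_fe_space Om G W : Prop :=
  submod_closed (mem W : {pred 'rV[R]_d -> R}) /\
  forall w, W w -> L2 Om w /\ piecewise_polynomial G w.

Definition is_basis Om W n (phi : 'I_n -> 'rV[R]_d -> R) : Prop :=
  [/\ forall k, W (phi k),
      forall c : 'I_n -> R,
        \sum_k c k *: phi k = 0 %[ae mu in Om] -> forall k, c k = 0
    & forall w, W w ->
        exists c : 'I_n -> R, w = \sum_k c k *: phi k %[ae mu in Om]].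

(* The support of a function defined up to equality almost everywhere: the
   complement of the largest open set on which v vanishes almost everywhere. *)
Definition ess_support Om v : set 'rV[R]_d :=
  [set x | forall U, nbhs x U -> ~ (v = 0 %[ae mu in U `&` Om])].

(* lam is a linear functional with domain V; its values outside V are
   irrelevant. *)
Definition is_linear_functional V (lam : ('rV[R]_d -> R) -> R) : Prop :=
  submod_closed (mem V : {pred 'rV[R]_d -> R}) /\
  forall a v w, V v -> V w -> lam (a *: v + w) = a * lam v + lam w.

(* For D a subdomain of Om, this also makes lam compatible with equality almost
   everywhere in Om. *)
Definition depends_only_on D V (lam : ('rV[R]_d -> R) -> R) : Prop :=
  forall v w, V v -> V w -> v = w %[ae mu in D] -> lam v = lam w.

Definition representable_in_others Om D n (phi : 'I_n -> 'rV[R]_d -> R)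
    (k : 'I_n) : Prop :=
  exists c : 'I_n -> R,
    phi k = \sum_(m < n | (m != k) &&
                `[< ess_support Om (phi m) `&` D° !=set0 >]) c m *: phi m
      %[ae mu in D].

End finite_element.

(* Main.v *)
Require Import Defs.
From mathcomp Require Import all_boot all_order all_algebra.
From mathcomp Require Import all_classical all_reals all_analysis.
Import Order.TTheory GRing.Theory Num.Theory.
Import numFieldNormedType.Exports.
Local Open Scope classical_set_scope.
Local Open Scope ring_scope.

(** If [phi k = \sum_m c m *: phi m] almost everywhere on [D k], with [m != k],
then applying [lam k], for which [lam k (phi m) = (m == k)%:R] by uniqueness of
coordinates, gives [1 = 0].  Conversely, [lam k] can only be the [k]-th
coordinate in the basis; if it did not depend only on the restriction to [D k],
some element of [Wh] would vanish on [D k] with a nonzero [k]-th coordinate, and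
dividing by that coordinate would represent [phi k] on [D k] by the other basis
functions.
Those whose support misses the interior of [D k] vanish almost everywhere on
[D k], by a Lindelöf argument, and can be dropped. *)

(** [lam] is linear on [V] only, so the induction must carry membership of the partial sums in [V]
    along with their values. *)
Lemma submod_linear_functional_sum {R : realType} {d : nat}
    {V : set ('rV[R]_d -> R)} {lam : ('rV[R]_d -> R) -> R} {n : nat}
    (P : pred 'I_n) (c : 'I_n -> R) {f : 'I_n -> 'rV[R]_d -> R} :
  is_linear_functional V lam -> (forall i, V (f i)) ->
  V (\sum_(i < n | P i) c i *: f i) /\
  lam (\sum_(i < n | P i) c i *: f i) = \sum_(i < n | P i) c i * lam (f i).
Proof.
move=> [[/set_mem V0 Vlin] lamlin] Vf.
have lam0 : lam 0 = 0.
  by have := lamlin 1 0 0 V0 V0; rewrite scaler0 addr0 mul1r => /eqP;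
    rewrite -subr_eq subrr => /eqP.
elim/big_rec2: _ => // i y s _ [Vs lams]; split; last by rewrite lamlin// lams.
by apply/set_mem/Vlin; apply/mem_set.
Qed.

(* Lindelöf: balls of rational centre and radius [1/(k+1)] are countably many. *)
Lemma ae_rV_local (R : realType) (d : nat)
    (mu : {measure set 'rV[R]_d -> \bar R}) (A : set 'rV[R]_d)
    (Q : 'rV[R]_d -> Prop) :
  (forall x, A x -> exists2 U, nbhs x U & \forall y \ae mu, U y -> Q y) ->
  \forall y \ae mu, A y -> Q y.
Proof.
move=> locQ.
pose B (q : 'rV[rat]_d * nat) : set 'rV[R]_d :=
  [set x | forall i, `|ratr (q.1 0 i) - x 0 i| < q.2.+1%:R^-1].
pose good q := \forall y \ae mu, B q y -> Q y.
(* Balls are indexed by their codes in [nat], so that countably many null sets are discarded at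
   once; a ball that is not [good] imposes nothing. *)
have : \forall y \ae mu, forall m : nat,
    if unpickle m is Some q then good q -> B q y -> Q y else True.
  apply: ae_foralln => m; case: unpickle => [q|]; last exact: aeW.
  have [gq|ngq] := pselect (good q); last exact: aeW.
  by apply: filterS gq => y.
apply: filterS => x hx Ax.
have [U /nbhs_ballP[e /= e0 xeU] UQ] := locQ x Ax.
(* Half of [e], because [x] and [y] are compared through the rational centre, each within one radius
   of it. *)
have [k ke] : exists k : nat, k.+1%:R^-1 < e / 2.
  have [k] := ltr_add_invr (divr_gt0 e0 (ltr0n _ 2) : 0 < e / 2).
  by rewrite add0r => ?; exists k.
have k0 : 0 < k.+1%:R^-1 :> R by rewrite invr_gt0 ltr0n.
have /choice[q xq] : forall i : 'I_d, exists q : rat,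
    `|ratr q - x 0 i| < k.+1%:R^-1.
  move=> i.
  have [|q] := @rat_in_itvoo R (x 0 i - k.+1%:R^-1) (x 0 i + k.+1%:R^-1).
    by rewrite ltrBlDr -addrA ltrDl addr_gt0.
  by rewrite in_itv/= => qi; exists q; rewrite ltr_distl.
have BU : B (\row_i q i, k) `<=` U.
  move=> y By; apply: xeU; split => // i j; rewrite (ord1 i) /ball/=.
  have := By j; rewrite /= mxE => qy.
  rewrite (le_lt_trans (ler_distD (ratr (q j)) _ _))// (splitr e) ltrD//.
    by rewrite distrC (lt_trans (xq j)).
  by rewrite (lt_trans qy).
have := hx (pickle (\row_i q i, k)); rewrite pickleK; apply.
- by apply: filterS UQ => y UQ /BU.
- by move=> i; rewrite /= mxE.
Qed.

Section subdomain.
Context {R : realType} {d : nat} {Om D : set 'rV[R]_d}.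
Hypothesis DOm : is_subdomain Om D.

Local Notation mu := (lebesgue_rV R d).

Lemma subdomain_ae_interior : \forall x \ae mu, D x -> D° x.
Proof.
have [_ _ _ nD] := DOm; apply: negligibleS nD => x /= /not_implyP[Dx nDx].
by split.
Qed.

(** [D] may stick out of [Om], but only by a part of the negligible set where it differs from
    [D°]. *)
Lemma ae_subdomain {Q : 'rV[R]_d -> Prop} :
  (\forall x \ae mu, Om x -> Q x) -> \forall x \ae mu, D x -> Q x.
Proof.
have [_ DsubOm _ _] := DOm.
move=> OmQ; have := subdomain_ae_interior.
by apply: filterS2 OmQ => x OmQ DD /DD /DsubOm /OmQ.
Qed.

Lemma ess_support_disjoint_ae0 {v : 'rV[R]_d -> R} :
  ~ (ess_support Om v `&` D° !=set0) -> v = 0 %[ae mu in D].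
Proof.
have [_ DsubOm _ _] := DOm => vD.
suff Dv : \forall x \ae mu, D° x -> v x = 0.
  have := subdomain_ae_interior.
  by apply: filterS2 Dv => x Dv DD /DD /Dv.
apply: ae_rV_local => x Dx.
have [U Ux Uv] : exists2 U, nbhs x U & v = 0 %[ae mu in U `&` Om].
  apply: contrapT => noU; apply: vD; exists x; split => // U Ux Uv.
  by apply: noU; exists U.
(* Cutting down to [D°] keeps the neighbourhood inside [Om], where the vanishing of [v] is known. *)
exists (U `&` D°).
  by apply: filterI => //; apply: open_nbhs_nbhs; split => //; exact: open_interior.
by apply: filterS Uv => y Uv [Uy /DsubOm Omy]; exact: Uv.
Qed.

Lemma representable_in_othersP {n : nat} {phi : 'I_n -> 'rV[R]_d -> R}
    {k : 'I_n} :
  representable_in_others Om D phi k <->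
  exists c : 'I_n -> R,
    phi k = \sum_(m < n | m != k) c m *: phi m %[ae mu in D].
Proof.
split=> -[c phik].
  exists (fun m => if `[< ess_support Om (phi m) `&` D° !=set0 >] then c m else 0).
  apply: filterS phik => x phik Dx; rewrite phik// big_mkcondr/=.
  by rewrite !fct_sumE; apply: eq_bigr => m _; case: ifP => //; rewrite scale0r.
exists c.
have supp0 : \forall x \ae mu, forall m,
    ~ (ess_support Om (phi m) `&` D° !=set0) -> D x -> phi m x = 0.
  apply: filter_forall => m.
  have [?|s0] := pselect (ess_support Om (phi m) `&` D° !=set0); first exact: aeW.
  by have := ess_support_disjoint_ae0 s0; apply: filterS => x ? _.
apply: filterS2 phik supp0 => x phik supp0 Dx; rewrite phik// big_mkcondr/=.
rewrite !fct_sumE; apply: eq_bigr => m _; case: asboolP => // /supp0 phim.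
by rewrite [LHS](_ : _ = c m * phi m x)// phim// mulr0.
Qed.

End subdomain.

(** Freeness applied to the differences [a k - b k]. *)
Lemma basis_coord_uniq {R : realType} {d n : nat} {Om : set 'rV[R]_d}
    {W : set ('rV[R]_d -> R)} {phi : 'I_n -> 'rV[R]_d -> R} (a b : 'I_n -> R) :
  is_basis Om W phi ->
  \sum_k a k *: phi k = \sum_k b k *: phi k %[ae lebesgue_rV R d in Om] ->
  a =1 b.
Proof.
move=> [_ phifree _] ab k; apply/eqP; rewrite -subr_eq0; apply/eqP.
apply: (phifree (fun k => a k - b k)) k; apply: filterS ab => x ab Omx.
under eq_bigr do rewrite scalerBl.
by rewrite sumrB [LHS](_ : _ = (\sum_k a k *: phi k) x - (\sum_k b k *: phi k) x)//
  ab// subrr.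
Qed.

Theorem theoremA2 (R : realType) (d n : nat)
    (Om : set 'rV[R]_d) (Gh : set (set 'rV[R]_d))
    (Wh : set ('rV[R]_d -> R)) (phi : 'I_n -> 'rV[R]_d -> R)
    (D : 'I_n -> set 'rV[R]_d) :
  is_domain Om ->
  is_subdivision Om Gh ->
  is_fe_space Om Gh Wh ->
  is_basis Om Wh phi ->
  (forall k, is_subdomain Om (D k)) ->
  (exists (V : 'I_n -> set ('rV[R]_d -> R))
          (lam : 'I_n -> ('rV[R]_d -> R) -> R),
      (forall k, [/\ is_linear_functional (V k) (lam k), Wh `<=` V k
                   & depends_only_on (D k) (V k) (lam k)]) /\
      (forall w, Wh w ->
         \sum_(k < n) lam k w *: phi k = w %[ae lebesgue_rV R d in Om])) <->
  (forall k : 'I_n, ~ representable_in_others Om (D k) phi k).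
Proof.
move=> _ _ [Wsub _] phiB DOm; have [Wphi _ phigen] := phiB.
split.
  move=> [V [lam [lamP lam_id]]] k /(representable_in_othersP (DOm k)).
  move=> [c phik].
  have [lamlin WV lamD] := lamP k.
  have Vphi m : V k (phi m) by exact/WV/Wphi.
  have lamphi m : lam k (phi m) = (m == k)%:R.
    have := basis_coord_uniq (fun j => lam j (phi m))
      (fun j => (m == j)%:R) phiB.
    apply; apply: filterS (lam_id _ (Wphi m)) => x lamx Omx; rewrite lamx//.
    rewrite (bigD1 m)//= eqxx scale1r big1 ?addr0// => j /negPf.
    by rewrite eq_sym => ->; rewrite scale0r.
  have [Vs lams] := submod_linear_functional_sum (fun m => m != k) c lamlin Vphi.
  have := lamD _ _ (Vphi k) Vs phik.
  rewrite lams lamphi eqxx big1 => [/eqP|m /negPf mk]; first by rewrite oner_eq0.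
  by rewrite lamphi mk mulr0.
move=> nrep.
(* Outside [Wh] the coordinates are set to zero, a junk value. *)
have /choice[c cP] : forall w, exists c : 'I_n -> R,
    Wh w -> w = \sum_k c k *: phi k %[ae lebesgue_rV R d in Om].
  move=> w; have [/phigen[c wc]|nw] := pselect (Wh w); last by exists (fun=> 0).
  by exists c.
exists (fun=> Wh), (fun k w => c w k); split; last first.
  by move=> w /cP; apply: filterS => x h /h.
move=> k; split=> //; first split=> //.
  move=> a v w Wv Ww.
  have Wavw : Wh (a *: v + w) by apply/set_mem/Wsub.2; apply/mem_set.
  apply: (basis_coord_uniq _ (fun j => a * c v j + c w j) phiB).
  apply: (filterS3 _ _ (cP _ Wavw) (cP _ Wv) (cP _ Ww)) => x havw hv hw Omx.
  rewrite -havw// [LHS](_ : _ = a * v x + w x)// hv// hw//.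
  under [in RHS]eq_bigr do rewrite scalerDl -scalerA.
  by rewrite big_split -scaler_sumr.
move=> v w Wv Ww vw; apply: contrapT => cvw; apply: (nrep k).
apply/(representable_in_othersP (DOm k)).
pose b j := c v j - c w j.
have bk0 : b k != 0 by rewrite subr_eq0; exact/eqP.
(* The [b j] are the coordinates of [v - w], which vanishes almost everywhere on [D k]; the relation
   is solved for [phi k]. *)
exists (fun j => - (b k)^-1 * b j).
have vD := ae_subdomain (DOm k) (cP _ Wv).
have wD := ae_subdomain (DOm k) (cP _ Ww).
apply: (filterS3 _ _ vw vD wD) => x vwx vx wx Dx.
have : \sum_j b j * phi j x = 0.
  under eq_bigr do rewrite mulrBl.
  rewrite sumrB; move: (vwx Dx); rewrite vx// wx// !fct_sumE => vwE.
  by apply/eqP; rewrite subr_eq0; apply/eqP.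
rewrite (bigD1 k)//= => /eqP; rewrite addr_eq0 => /eqP bphi.
rewrite fct_sumE [RHS](_ : _ = - (b k)^-1 * \sum_(j < n | j != k) b j * phi j x).
  by rewrite mulNr -mulrN -bphi mulKf.
by rewrite mulr_sumr; apply: eq_bigr => j _; rewrite mulrA.
Qed.
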